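(* For every finite lattice $\mathcal{L}$ there is a bitransversal matroid $M$ such that the lattice $\mathcal{Z}(M)$ of cyclic flats of $M$ is isomorphic to $\mathcal{L}$.
   Context: All matroids are finite. A flat of a matroid is cyclic if it is a (possibly empty) union of circuits. The cyclic flats of a matroid $M$, ordered by inclusion, form a lattice $\mathcal{Z}(M)$: the join of cyclic flats $A,B$ is $\mathrm{cl}(A\cup B)$ and their meet is the union of all circuits contained in $A\cap B$. A matroid is bitransversal if it is both transversal and cotransversal (i.e. both it and its dual are transversal matroids). *)

(* Defs.v *)
From HB Require Import structures.
From mathcomp Require Import all_boot all_order.

Set Implicit Arguments.
Unset Strict Implicit.
Unset Printing Implicit Defensive.

Record matroid (E : finType) := Matroid {
  indep : {set {set E}};
  indep0 : set0 \in indep;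
  indepS : forall I J : {set E}, I \subset J -> J \in indep -> I \in indep;
  indep_aug : forall I J : {set E}, I \in indep -> J \in indep -> #|I| < #|J| ->
    exists2 x, x \in J :\: I & x |: I \in indep
}.

Definition rank (E : finType) (M : matroid E) (X : {set E}) : nat :=
  \max_(I in indep M | I \subset X) #|I|.

Definition basis (E : finType) (M : matroid E) (B : {set E}) : bool :=
  maxset (fun I => I \in indep M) B.

Definition circuits (E : finType) (M : matroid E) : {set {set E}} :=
  [set C | minset (fun X => X \notin indep M) C].

Definition cl (E : finType) (M : matroid E) (X : {set E}) : {set E} :=
  [set e | rank M (e |: X) == rank M X].

Definition is_flat (E : finType) (M : matroid E) (F : {set E}) : bool :=
  cl M F == F.

Definition is_cyclic (E : finType) (M : matroid E) (A : {set E}) : bool :=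
  [exists S : {set {set E}}, (S \subset circuits M) && (A == cover S)].

Definition is_cyclic_flat (E : finType) (M : matroid E) (A : {set E}) : bool :=
  is_flat M A && is_cyclic M A.

Section Closure.
Variables (E : finType) (M : matroid E).
Implicit Types (X Y I J C : {set E}) (e : E).

Lemma leq_rank I X : I \in indep M -> I \subset X -> #|I| <= rank M X.
Proof.
by move=> iI sIX; apply: (@leq_bigmax_cond _ _ (fun I : {set E} => #|I|)); rewrite iI.
Qed.

Lemma indep_extend I X : I \in indep M -> I \subset X ->
  exists J, [/\ I \subset J, J \subset X, J \in indep M & #|J| = rank M X].
Proof.
move=> iI sIX; pose P J := (J \in indep M) && (J \subset X).
have [|J /maxsetP[/andP[iJ sJX] maxJ] sIJ] := @maxset_exists _ P I; first exact/andP.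
exists J; split=> //; apply/eqP; rewrite eqn_leq leq_rank //=.
apply/bigmax_leqP=> K /andP[iK sKX]; rewrite leqNgt; apply/negP=> ltJK.
have [x /setDP[xK xJ] ixJ] := indep_aug iJ iK ltJK.
have := maxJ (x |: J); rewrite /P ixJ subsetUr subUset sub1set (subsetP sKX) //= sJX.
by move=> /(_ isT isT) eqJ; move: xJ; rewrite -eqJ setU11.
Qed.

Lemma rank_witness X :
  exists I, [/\ I \in indep M, I \subset X & #|I| = rank M X].
Proof.
have [I [_ sIX iI cI]] := indep_extend (indep0 M) (sub0set X).
by exists I.
Qed.

Lemma mem_cl I X e : I \in indep M -> I \subset X -> #|I| = rank M X ->
  (e \in cl M X) = (e \in I) || (e |: I \notin indep M).
Proof.
move=> iI sIX cI; rewrite inE; apply/idP/idP => [/eqP eqr|].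
  apply: contraT; rewrite negb_or negbK => /andP[eI ieI].
  have := leq_rank ieI (setUS [set e] sIX).
  by rewrite eqr -cI cardsU1 eI ltnn.
have le1 : rank M X <= rank M (e |: X).
  by rewrite -cI; apply: leq_rank => //; apply: subset_trans sIX (subsetUr _ _).
apply: contraLR => neq; have {le1}lt1 : rank M X < rank M (e |: X).
  by rewrite ltn_neqAle eq_sym neq.
have [J [iJ sJ cJ]] := rank_witness (e |: X).
have [|x /setDP[xJ xI] ixI] := indep_aug iI iJ; first by rewrite cI cJ.
have xX : x \notin X.
  apply/negP=> xX; have : x |: I \subset X by rewrite subUset sub1set xX.
  by move/(leq_rank ixI); rewrite -cI cardsU1 xI ltnn.
have /eqP ex : x == e by move/(subsetP sJ): xJ; rewrite !inE (negbTE xX) orbF.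
by rewrite negb_or negbK -ex xI.
Qed.

Lemma sub_cl X : X \subset cl M X.
Proof. by apply/subsetP=> e eX; rewrite inE (setUidPr _) ?sub1set. Qed.

Lemma clS X Y : X \subset Y -> cl M X \subset cl M Y.
Proof.
move=> sXY; have [I [iI sIX cI]] := rank_witness X.
have [J [sIJ sJY iJ cJ]] := indep_extend iI (subset_trans sIX sXY).
apply/subsetP=> e; rewrite (mem_cl _ iI sIX cI) (mem_cl _ iJ sJY cJ).
case/orP=> [/(subsetP sIJ) -> //|ne]; apply/orP; right.
by apply: contra ne; apply: indepS; apply: setUS.
Qed.

Lemma cl_idem X : cl M (cl M X) = cl M X.
Proof.
have [I [iI sIX cI]] := rank_witness X.
have sIc := subset_trans sIX (sub_cl X).
have [J [sIJ sJc iJ cJ]] := indep_extend iI sIc.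
have sJI : J \subset I.
  apply/subsetP=> e eJ; move/(subsetP sJc): (eJ).
  rewrite (mem_cl _ iI sIX cI) => /orP[//|/negP[]].
  by apply: indepS iJ; rewrite subUset sub1set eJ.
have eIJ : J = I by apply/eqP; rewrite eqEsubset sJI.
rewrite eIJ in cJ.
by apply/setP=> e; rewrite (mem_cl _ iI sIc cJ) (mem_cl _ iI sIX cI).
Qed.

Lemma cl_circuit X e : e \in cl M X -> e \notin X ->
  exists2 C, C \in circuits M & (e \in C) && (C \subset e |: X).
Proof.
have [I [iI sIX cI]] := rank_witness X.
rewrite (mem_cl _ iI sIX cI) => /orP[/(subsetP sIX) -> //|neI] _.
have [C mC sC] := @minset_exists _ (fun X => X \notin indep M) _ neI.
exists C; first by rewrite inE.
rewrite (subset_trans sC (setUS _ sIX)) andbT; apply: contraT => eC.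
have /minsetP[/negP[]] := mC; apply: indepS iI; apply/subsetP=> x xC.
by move/(subsetP sC): (xC); rewrite !inE => /orP[/eqP ex|//]; rewrite -ex xC in eC.
Qed.

Lemma is_cyclicP X :
  reflect (forall x, x \in X ->
             exists2 C, C \in circuits M & (x \in C) && (C \subset X))
          (is_cyclic M X).
Proof.
apply: (iffP existsP) => [[S /andP[/subsetP sS /eqP ->]] x|h].
  case/bigcupP=> C CS xC; exists C; first exact: sS.
  by rewrite xC; apply/subsetP=> y yC; apply/bigcupP; exists C.
exists [set C in circuits M | C \subset X]; apply/andP; split.
  by apply/subsetP=> C; rewrite inE => /andP[].
rewrite eqEsubset; apply/andP; split.
  by apply/subsetP=> x /h[C cC /andP[xC sC]]; apply/bigcupP; exists C; rewrite // inE cC.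
by apply/bigcupsP=> C; rewrite inE => /andP[].
Qed.

Lemma join_cyclic_flat A B : is_cyclic_flat M A -> is_cyclic_flat M B ->
  is_cyclic_flat M (cl M (A :|: B)).
Proof.
case/andP=> _ /is_cyclicP cA /andP[_ /is_cyclicP cB].
rewrite /is_cyclic_flat /is_flat cl_idem eqxx /=; apply/is_cyclicP=> x xcl.
have sub := sub_cl (A :|: B).
have [xAB|xAB] := boolP (x \in A :|: B); last first.
  have [C cC /andP[xC sC]] := cl_circuit xcl xAB; exists C; rewrite // xC.
  by apply: subset_trans sC _; rewrite subUset sub1set xcl.
case/setUP: xAB => [/cA|/cB] [C cC /andP[xC sC]]; exists C; rewrite // xC;
  apply: subset_trans sC (subset_trans _ sub); [exact: subsetUl|exact: subsetUr].
Qed.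

Lemma meet_cyclic_flat A B : is_cyclic_flat M A -> is_cyclic_flat M B ->
  is_cyclic_flat M (\bigcup_(C in circuits M | C \subset A :&: B) C).
Proof.
case/andP=> /eqP fA _ /andP[/eqP fB _]; set U := \bigcup_(C in _ | _) C.
have sU : U \subset A :&: B by apply/bigcupsP=> C /andP[].
apply/andP; split; last first.
  apply/is_cyclicP=> x /bigcupP[C /andP[cC sC] xC]; exists C; rewrite // xC.
  by apply: (@bigcup_sup _ _ C); rewrite cC.
rewrite /is_flat eqEsubset sub_cl andbT; apply/subsetP=> e ecl.
apply: contraT => eU; have [C cC /andP[eC sC]] := cl_circuit ecl eU.
case/negP: eU; apply/bigcupP; exists C; rewrite // cC.
have clAB : cl M U \subset A :&: B.
  rewrite subsetI -{1}fA -{1}fB; move: sU; rewrite subsetI => /andP[? ?].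
  by rewrite !clS.
apply: subset_trans sC _.
by rewrite subUset sub1set (subsetP clAB) //.
Qed.

End Closure.

(* The lattice Z(M), with join and meet given by join_cf and meet_cf below. *)
Record cyclic_flat (E : finType) (M : matroid E) := CyclicFlat {
  cyclic_flat_set :> {set E};
  cyclic_flatP : is_cyclic_flat M cyclic_flat_set
}.

Fact cyclic_flat_display : Order.disp_t. Proof. by []. Qed.

Section CyclicFlatLattice.
Variables (E : finType) (M : matroid E).
Implicit Types A B : cyclic_flat M.

HB.instance Definition _ := [isSub for @cyclic_flat_set E M].
HB.instance Definition _ := [Finite of cyclic_flat M by <:].

Definition le_cyclic_flat A B : bool := (A : {set E}) \subset B.

Fact le_cyclic_flat_refl : reflexive le_cyclic_flat.
Proof. by move=> A; apply: subxx. Qed.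

Fact le_cyclic_flat_anti : antisymmetric le_cyclic_flat.
Proof. by move=> A B le_AB; apply/val_inj/eqP; rewrite eqEsubset. Qed.

Fact le_cyclic_flat_trans : transitive le_cyclic_flat.
Proof. by move=> B A C; apply: subset_trans. Qed.

HB.instance Definition _ :=
  Order.Le_isPOrder.Build cyclic_flat_display (cyclic_flat M)
    le_cyclic_flat_refl le_cyclic_flat_anti le_cyclic_flat_trans.

Definition join_cf A B : cyclic_flat M :=
  CyclicFlat (join_cyclic_flat (cyclic_flatP A) (cyclic_flatP B)).

Definition meet_cf A B : cyclic_flat M :=
  CyclicFlat (meet_cyclic_flat (cyclic_flatP A) (cyclic_flatP B)).

Fact meet_cfP A B C :
  (A <= meet_cf B C)%O = (A <= B)%O && (A <= C)%O.
Proof.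
rewrite /Order.le /= /le_cyclic_flat /= -subsetI; apply/idP/idP => h.
  by apply: subset_trans h _; apply/bigcupsP=> D /andP[].
have /andP[_ /is_cyclicP cA] := cyclic_flatP A.
apply/subsetP=> x /cA[D cD /andP[xD sD]]; apply/bigcupP; exists D => //.
by rewrite cD (subset_trans sD h).
Qed.

Fact join_cfP A B C :
  (join_cf A B <= C)%O = (A <= C)%O && (B <= C)%O.
Proof.
rewrite /Order.le /= /le_cyclic_flat /= -subUset; apply/idP/idP => h.
  exact: subset_trans (sub_cl M _) h.
have /andP[/eqP fC _] := cyclic_flatP C.
by rewrite -fC clS.
Qed.

HB.instance Definition _ :=
  Order.POrder_MeetJoin_isLattice.Build cyclic_flat_display (cyclic_flat M)
    meet_cfP join_cfP.

End CyclicFlatLattice.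

Section Dual.
Variables (E : finType) (M : matroid E).
Implicit Types (X Y I J B : {set E}).

(* The bases of the dual are the complements of the bases of M (basis_dual). *)
Definition dual_indep : {set {set E}} :=
  [set X : {set E} | [exists B : {set E}, basis M B && (X \subset ~: B)]].

Lemma basis_rank B : basis M B = (B \in indep M) && (#|B| == rank M setT).
Proof.
apply/idP/andP => [/maxsetP[iB maxB]|[iB /eqP cB]].
  have [J [sBJ _ iJ cJ]] := indep_extend iB (subsetT B).
  by rewrite iB -cJ (maxB J).
apply/maxsetP; split=> // J iJ sBJ; apply/eqP; rewrite eq_sym eqEcard sBJ cB.
exact: leq_rank (subsetT _).
Qed.

Fact dual_indep0 : set0 \in dual_indep.
Proof.
have [B [iB _ cB]] := rank_witness M setT.
by rewrite inE; apply/existsP; exists B; rewrite basis_rank iB cB eqxx sub0set.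
Qed.

Fact dual_indepS X Y : X \subset Y -> Y \in dual_indep -> X \in dual_indep.
Proof.
move=> sXY; rewrite !inE => /existsP[B /andP[bB sY]]; apply/existsP; exists B.
by rewrite bB (subset_trans sXY sY).
Qed.

Fact dual_indep_aug X Y : X \in dual_indep -> Y \in dual_indep -> #|X| < #|Y| ->
  exists2 x, x \in Y :\: X & x |: X \in dual_indep.
Proof.
rewrite !inE => /existsP[B /andP[]]; rewrite basis_rank => /andP[iB /eqP cB] sXB.
case/existsP=> B' /andP[]; rewrite basis_rank => /andP[iB' /eqP cB'] sYB' ltXY.
have iD : B' :\: X \in indep M by apply: indepS iB'; apply: subsetDl.
have sD : B' :\: X \subset ~: X by rewrite subDset setUCr subsetT.
have [J [sDJ sJX iJ cJ]] := indep_extend iD sD.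
have cJT : #|J| = rank M setT.
  apply/eqP; rewrite eqn_leq leq_rank //= cJ -cB leq_rank //.
  by rewrite -setCS setCK.
have [sYJ|] := boolP (Y :\: X \subset J); last first.
  case/subsetPn=> y yYX yJ; exists y => //; rewrite inE.
  apply/existsP; exists J; rewrite basis_rank iJ cJT eqxx /=.
  by rewrite subUset sub1set inE yJ /= -setCS setCK.
have disj : [disjoint B' :\: X & Y :\: X].
  rewrite -setI_eq0; apply/eqP/setP=> z; rewrite !inE.
  have [zY|] := boolP (z \in Y); last by rewrite !andbF.
  by move/(subsetP sYB'): zY; rewrite inE => /negbTE ->; rewrite andbF.
have : #|B' :\: X| + #|Y :\: X| <= #|J|.
  rewrite -cardsUI; move: disj; rewrite -setI_eq0 => /eqP ->; rewrite cards0 addn0.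
  by apply: subset_leq_card; rewrite subUset sDJ.
rewrite cJT -cB' -(cardsID X B') addnC leq_add2r => h.
have : #|B' :&: X| <= #|X :\: Y|.
  apply: subset_leq_card; apply/subsetP=> z /setIP[zB zX]; rewrite inE zX andbT.
  by apply/negP=> /(subsetP sYB'); rewrite inE zB.
move=> /(leq_trans h); rewrite leqNgt; case/negP.
by rewrite -(ltn_add2l #|X :&: Y|) cardsID setIC cardsID.
Qed.

Definition dual : matroid E := Matroid dual_indep0 dual_indepS dual_indep_aug.

Lemma basis_dual B : basis dual B = basis M (~: B).
Proof.
apply/idP/idP => [/maxsetP[]|bB].
  rewrite inE => /existsP[B' /andP[bB' sB]] maxB.
  rewrite -(maxB (~: B')) ?setCK // inE; apply/existsP; exists B'.
  by rewrite bB' subxx.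
apply/maxsetP; split.
  by rewrite inE; apply/existsP; exists (~: B); rewrite bB setCK subxx.
move=> Y; rewrite inE => /existsP[B' /andP[bB' sY]] sBY.
have sB' : B' \subset ~: B by rewrite -setCS setCK (subset_trans sBY).
have /maxsetP[_ maxB'] := bB'; have /maxsetP[iB _] := bB.
apply/eqP; rewrite eqEsubset sBY andbT; apply: subset_trans sY _.
by rewrite -(maxB' _ iB sB') setCK.
Qed.

End Dual.

(* phi is defined on X only, so that the empty set is a partial transversal
   even when J is empty. *)
Definition partial_transversal (E J : finType) (A : J -> {set E}) (X : {set E}) : Prop :=
  exists phi : {x : E | x \in X} -> J,
    injective phi /\ forall x, val x \in A (phi x).

(* The presentation (A j) is an indexed family, so members may repeat. *)
Definition transversal_matroid (E : finType) (M : matroid E) : Prop :=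
  exists (J : finType) (A : J -> {set E}),
    forall X : {set E}, X \in indep M <-> partial_transversal A X.

Definition cotransversal_matroid (E : finType) (M : matroid E) : Prop :=
  transversal_matroid (dual M).

Definition bitransversal_matroid (E : finType) (M : matroid E) : Prop :=
  transversal_matroid M /\ cotransversal_matroid M.

Definition lattice_isomorphic (d d' : Order.disp_t)
    (L : latticeType d) (L' : latticeType d') : Prop :=
  exists f : L -> L',
    [/\ bijective f,
        {morph f : x y / Order.meet x y >-> Order.meet x y}
      & {morph f : x y / Order.join x y >-> Order.join x y}].

(* Main.v *)
(* Let E consist of two copies of L and let M be the transversal matroid of the
   sets A_y = {inl y} U {inr x : not x <= y}, so that inr x is placed freely on
   the face N x = {y : not x <= y} of the simplex with vertices inl y. The cyclic
   flats of M are spanned by the unions of faces N x. As N (x v z) is the union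
   of N x and N z and N x is contained in N z iff x <= z, every such union is
   itself a face and the cyclic flats form a copy of L. The dual of M is a
   matroid of the same kind with the two copies of L exchanged. *)

Require Import Defs.
From mathcomp Require Import all_boot all_order.

Set Implicit Arguments.
Unset Strict Implicit.
Unset Printing Implicit Defensive.

Import Order.TTheory.

(** * Transversal matroids via matchings *)

Section TransversalMatroid.
Variables (E J : finType) (j0 : J) (A : J -> {set E}).
Implicit Types (X Y : {set E}) (f g : E -> J).

Definition matches X f := {in X &, injective f} /\ {in X, forall x, x \in A (f x)}.

Definition transversal_indep : {set {set E}} :=
  [set X : {set E} | [exists f : {ffun E -> J},
    dinjectiveb f X && [forall x in X, x \in A (f x)]]].

Lemma transversal_indepP X :
  reflect (exists f, matches X f) (X \in transversal_indep).
Proof.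
rewrite inE; apply: (iffP existsP) => [[f /andP[/dinjectiveP injf /forall_inP Af]]|[f [injf Af]]].
  by exists f; split=> // x /Af.
exists (finfun f); apply/andP; split.
  by apply/dinjectiveP=> x y xX yX; rewrite !ffunE; apply: injf.
by apply/forall_inP=> x xX; rewrite ffunE Af.
Qed.

Lemma matchesS X Y f : X \subset Y -> matches Y f -> matches X f.
Proof.
move=> /subsetP sXY [injf Af].
by split=> [x y /sXY xY /sXY yY|x /sXY]; [apply: injf|apply: Af].
Qed.

(** Whether or not [x] already lies in [X], [j] is free for it: the same map serves to add [x] to a
    matching and to give [x] a new partner. *)
Lemma matches_update X f x j : matches (X :\ x) f -> x \in A j ->
  {in X :\ x, forall y, f y != j} ->
  matches (x |: X) (fun y => if y == x then j else f y).
Proof.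
move=> [injf Af] xj fj.
have inX y : y \in x |: X -> y != x -> y \in X :\ x.
  by rewrite !inE => /orP[->|->] // ->.
split=> [y z yX zX|y yX]; last by case: eqVneq => [->|/(inX _ yX)/Af].
case: eqVneq => [->|/(inX _ yX) y'X]; case: eqVneq => [->|/(inX _ zX) z'X] //.
- by move/esym/eqP; rewrite (negbTE (fj _ _)).
- by move/eqP; rewrite (negbTE (fj _ _)).
exact: injf.
Qed.

Lemma transversal_indep0 : set0 \in transversal_indep.
Proof. by apply/transversal_indepP; exists (fun=> j0); split=> x; rewrite inE. Qed.

Lemma transversal_indepS X Y :
  X \subset Y -> Y \in transversal_indep -> X \in transversal_indep.
Proof.
move=> sXY /transversal_indepP[f /(matchesS sXY) fX].
by apply/transversal_indepP; exists f.
Qed.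

(* A member [j] used by [Y] but not by [X] either extends the matching of [X] or
   can replace the partner of an element of [X], after which the two matchings
   agree at one more element. *)
Lemma transversal_indep_aug X Y :
  X \in transversal_indep -> Y \in transversal_indep -> #|X| < #|Y| ->
  exists2 x, x \in Y :\: X & x |: X \in transversal_indep.
Proof.
move=> /transversal_indepP[f fX] /transversal_indepP[g [injg Ag]] ltXY.
have [n le_n] := ubnP #|[set x in X | f x != g x]|.
elim: n => // n IHn in f fX le_n *.
have [/subset_leq_card|] := boolP (g @: Y \subset f @: X).
  by rewrite (card_in_imset injg) (card_in_imset fX.1) leqNgt ltXY.
case/subsetPn=> _ /imsetP[x xY ->] gxX.
have fgx : {in X, forall y, f y != g x}.
  by move=> y yX; apply: contra gxX => /eqP <-; apply: imset_f.
have fX' := matches_update (matchesS (subsetDl _ _) fX) (Ag _ xY)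
  (sub_in1 (subsetP (subsetDl X [set x])) fgx).
have [xX|xX] := boolP (x \in X); last first.
  exists x; first by rewrite inE xX.
  by apply/transversal_indepP; eexists; exact: fX'.
rewrite (setUidPr _) ?sub1set // in fX'; apply: IHn fX' _.
rewrite -ltnS; apply: leq_trans le_n; rewrite ltnS; apply: proper_card.
apply/properP; split.
  by apply/subsetP=> y; rewrite !inE; case: (eqVneq y x) => // ->; rewrite eqxx andbF.
by exists x; rewrite !inE xX ?fgx //= !eqxx.
Qed.

Definition transversal : matroid E :=
  Matroid transversal_indep0 transversal_indepS transversal_indep_aug.

(** [matches] uses total functions and [partial_transversal] functions on the subtype of [X]; [j0]
    fills in the values outside [X]. *)
Lemma partial_transversalP X :
  (exists f, matches X f) <-> partial_transversal A X.
Proof.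
split=> [[f [injf Af]]|[phi [inj_phi Aphi]]].
  exists (fun x => f (val x)); split=> [x y /injf eqxy|x]; last exact: Af (valP x).
  by apply/val_inj/eqxy; apply: valP.
exists (fun x => if insub x is Some u then phi u else j0); split=> [x y xX yX|x xX].
  by rewrite !insubT => /inj_phi[].
by rewrite insubT -[x in x \in _]/(val (Sub x xX : {x : E | x \in X})) Aphi.
Qed.

(** The inverse of [h] matches its image. *)
Lemma transversal_indep_imset (h : J -> E) :
  injective h -> (forall j, h j \in A j) -> h @: [set: J] \in transversal_indep.
Proof.
move=> injh Ah; apply/transversal_indepP.
exists (fun x => odflt j0 [pick j | h j == x]).
have hK j : odflt j0 [pick i | h i == h j] = j.
  by case: pickP => [i /eqP/injh //|/(_ j)/eqP].
by split=> [_ _ /imsetP[i _ ->] /imsetP[j _ ->]|_ /imsetP[j _ ->]]; rewrite !hK // => ->.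
Qed.

Lemma leq_card_transversal X : X \in transversal_indep -> #|X| <= #|J|.
Proof.
by case/transversal_indepP=> f [injf _]; rewrite -(card_in_imset injf) max_card.
Qed.

End TransversalMatroid.

Lemma transversal_matroid_transversal (E J : finType) (j0 : J) (A : J -> {set E}) :
  transversal_matroid (transversal j0 A).
Proof.
exists J, A => X; apply: iff_trans (partial_transversalP j0 A X).
by split=> /transversal_indepP.
Qed.

(** * Circuits and closure in an arbitrary matroid *)

Lemma circuit_setD1_indep (E : finType) (M : matroid E) (C : {set E}) x :
  C \in circuits M -> x \in C -> C :\ x \in indep M.
Proof.
rewrite inE => /minsetP[_ minC] xC; apply: contraT => /minC/(_ (subsetDl _ _)) eqC.
by have := setD11 x C; rewrite eqC xC.
Qed.

Lemma cl_sub_flat (E : finType) (M : matroid E) (X F : {set E}) :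
  is_flat M F -> X \subset F -> cl M X \subset F.
Proof. by move=> /eqP fF /(clS M); rewrite fF. Qed.

Lemma mem_cl_indep (E : finType) (M : matroid E) (I : {set E}) x :
  I \in indep M -> (x \in cl M I) = (x \in I) || (x |: I \notin indep M).
Proof.
move=> iI; apply: mem_cl => //; apply/eqP; rewrite eqn_leq leq_rank //=.
by apply/bigmax_leqP=> X /andP[_ /subset_leq_card].
Qed.

(** * Fundamental transversal matroids: points [inr s] placed freely on faces of a simplex *)

Section Fundamental.
Variables (B S : finType) (b0 : B) (s0 : S) (N : S -> {set B}).
Implicit Types (X F : {set B + S}) (Y : {set B}) (b : B) (s : S).

Definition star b : {set B + S} := inl b |: [set inr s | s in [set s | b \in N s]].
(** The fundamental circuit of [inr s] in the basis of all vertices [inl b]; these sets also present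
    the dual. *)
Definition costar s : {set B + S} := inr s |: [set inl b | b in N s].

Definition fundamental : matroid (B + S)%type := transversal b0 star.
Local Notation M := fundamental.

Lemma in_inl Y b : (@inl B S b \in [set inl b | b in Y]) = (b \in Y).
Proof. by rewrite mem_imset // => ? ? []. Qed.

Lemma in_inr (T : {set S}) s : (@inr B S s \in [set inr s | s in T]) = (s \in T).
Proof. by rewrite mem_imset // => ? ? []. Qed.

Lemma inr_inl Y s : (@inr B S s \in [set inl b | b in Y]) = false.
Proof. by apply/imsetP=> -[]. Qed.

Lemma inl_inr (T : {set S}) b : (@inl B S b \in [set inr s | s in T]) = false.
Proof. by apply/imsetP=> -[]. Qed.

Lemma inl_star b c : (inl b \in star c) = (b == c).
Proof. by rewrite !inE inl_inr orbF. Qed.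

Lemma inr_star s b : (inr s \in star b) = (b \in N s).
Proof. by rewrite !inE in_inr inE. Qed.

Lemma inr_costar s t : (inr s \in costar t) = (s == t).
Proof. by rewrite !inE inr_inl orbF. Qed.

Lemma inl_costar b s : (inl b \in costar s) = (b \in N s).
Proof. by rewrite !inE in_inl. Qed.

Definition starE := (inl_star, inr_star, inl_costar, inr_costar).

Lemma fundamentalP X : reflect (exists f, matches star X f) (X \in indep M).
Proof. exact: transversal_indepP. Qed.

Lemma matches_inl X f b : matches star X f -> inl b \in X -> f (inl b) = b.
Proof. by case=> _ Af /Af; rewrite inl_star => /eqP. Qed.

Lemma indep_inl Y : [set inl b | b in Y] \in indep M.
Proof.
apply/fundamentalP; exists (fun x => if x is inl b then b else b0).
split=> [_ _ /imsetP[b _ ->] /imsetP[c _ ->] -> //|_ /imsetP[b _ ->]].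
by rewrite inl_star.
Qed.

Lemma rank_fundamental : rank M setT = #|B|.
Proof.
apply/eqP; rewrite eqn_leq; apply/andP; split.
  by apply/bigmax_leqP=> X /andP[/leq_card_transversal].
rewrite -[#|B|]cardsT -(@card_imset _ _ (@inl B S)) => [|? ? [] //].
by apply: leq_rank (subsetT _); apply: indep_inl.
Qed.

Lemma indep_inrU Y s b : b \in N s -> b \notin Y ->
  inr s |: [set inl b | b in Y] \in indep M.
Proof.
move=> bs bY; have /fundamentalP[f fY] := indep_inl Y.
apply/fundamentalP; eexists; apply: (matches_update (j := b) (f := f)).
- exact: matchesS (subsetDl _ _) fY.
- by rewrite inr_star.
move=> x /setD1P[_ xY]; case/imsetP: (xY) => c cY def_x; rewrite def_x in xY *.
by rewrite (matches_inl fY xY); apply: contraNneq bY => <-.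
Qed.

(** Each [inl b] can only be matched to [b], so [inr s] finds no free vertex in its face. *)
Lemma dep_costar s Y : N s \subset Y -> inr s |: [set inl b | b in Y] \notin indep M.
Proof.
move=> sNY; apply/fundamentalP=> -[f fY].
have := fY.2 (inr s); rewrite setU11 inr_star => /(_ isT) fs.
have inY : inl (f (inr s)) \in inr s |: [set inl b | b in Y].
  by rewrite !inE in_inl (subsetP sNY).
have := matches_inl fY inY => /fY.1.
by rewrite inY setU11 => /(_ isT isT).
Qed.

(** For minimality: removing some [inl b] frees [b] for [inr s], and removing [inr s] leaves only
    vertices. *)
Lemma circuit_costar s : costar s \in circuits M.
Proof.
rewrite inE; apply/minsetP; split=> [|X depX sX]; first exact: dep_costar.
apply/eqP; rewrite eqEsubset sX; apply: contraR depX.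
case/subsetPn=> x xs xX.
have subX (Y : {set B}) : {in N s, forall b, inl b \in X -> b \in Y} ->
    X \subset inr s |: [set inl b | b in Y].
  move=> XY; apply/subsetP=> y yX; have := subsetP sX _ yX.
  case: y yX => [b|t] yX; rewrite starE !inE ?in_inl; last by move/eqP->; rewrite eqxx.
  by move=> /XY->.
case: x xs xX => [b|t]; rewrite starE.
  move=> bs xX; apply: indepS (indep_inrU (Y := N s :\ b) bs _); last by rewrite !inE eqxx.
  by apply: subX => c cs cX; rewrite !inE cs andbT; apply: contraNneq xX => <-.
move=> /eqP-> xX; apply: indepS (indep_inl (N s)); apply/subsetP=> y yX.
have := subsetP (subX (N s) (fun _ bs _ => bs)) y yX.
by case/setU1P=> // def_y; rewrite -def_y yX in xX.
Qed.

Lemma circuit_star C x f b : C \in circuits M -> x \in C ->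
  matches star (C :\ x) f -> x \in star b -> exists2 y, y \in C :\ x & f y = b.
Proof.
move=> cC xC fC xb; have [/exists_inP[y yC /eqP]|noy] := boolP [exists y in C :\ x, f y == b].
  by exists y.
have /minsetP[/negP[]] : minset (fun X => X \notin indep M) C by rewrite inE in cC.
rewrite -(setD1K xC); apply/fundamentalP; eexists.
apply: (matches_update (f := f)) (xb) _.
  exact: matchesS (subsetDl _ _) fC.
move=> y /setD1P[_ yC]; apply: contra noy => fy.
by apply/exists_inP; exists y.
Qed.

(** * Cyclic flats as spans of unions of faces *)

Definition flat_of Y : {set B + S} :=
  [set inl b | b in Y] :|: [set inr s | s in [set s | N s \subset Y]].

Lemma inl_flat_of Y b : (inl b \in flat_of Y) = (b \in Y).
Proof. by rewrite inE in_inl inl_inr orbF. Qed.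

Lemma inr_flat_of Y s : (inr s \in flat_of Y) = (N s \subset Y).
Proof. by rewrite inE in_inr inr_inl inE. Qed.

Lemma cl_inl Y : cl M [set inl b | b in Y] = flat_of Y.
Proof.
apply/setP=> -[b|s]; rewrite mem_cl_indep ?indep_inl // ?in_inl ?inr_inl.
  rewrite inl_flat_of; case: (boolP (b \in Y)) => //= _.
  rewrite -imsetU1; apply/negbTE; rewrite negbK; exact: indep_inl.
rewrite inr_flat_of /=; apply/idP/idP => [|/dep_costar //].
by apply: contraR => /subsetPn[b bs bY]; apply: indep_inrU bs bY.
Qed.

(** The circuits [costar s] with [N s \subset Y] cover [flat_of Y]. *)
Lemma is_cyclic_flat_of Y :
  {in Y, forall b, exists2 s, N s \subset Y & b \in N s} -> is_cyclic_flat M (flat_of Y).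
Proof.
move=> cY; rewrite /is_cyclic_flat /is_flat -cl_inl cl_idem eqxx cl_inl /=.
have costarY s : N s \subset Y -> costar s \subset flat_of Y.
  move=> sY; apply/subsetP=> -[b|t]; rewrite starE.
    by rewrite inl_flat_of; apply: subsetP.
  by move/eqP->; rewrite inr_flat_of.
apply/is_cyclicP=> -[b|s].
  rewrite inl_flat_of => /cY[s sY bs]; exists (costar s); first exact: circuit_costar.
  by rewrite starE bs costarY.
rewrite inr_flat_of => sY; exists (costar s); first exact: circuit_costar.
by rewrite starE eqxx costarY.
Qed.

Definition base_part F : {set B} := [set b | inl b \in F].

Lemma base_partE F b : (b \in base_part F) = (inl b \in F).
Proof. by rewrite inE. Qed.

(* If [C] is a circuit through [inr s] and [b \in N s], then a matching of
   [inl b |: C :\ inr s] sends [inl b] to [b], so that on [C :\ inr s] it leaves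
   [b] free for [inr s]. *)
Lemma cyclic_flat_inr F s :
  is_cyclic_flat M F -> (inr s \in F) = (N s \subset base_part F).
Proof.
case/andP=> fF /is_cyclicP cF; apply/idP/idP => [sF|sNF].
  have [C cC /andP[sC sCF]] := cF _ sF.
  have iC := circuit_setD1_indep cC sC.
  apply/subsetP=> b bs; rewrite base_partE; have [bC|bC] := boolP (inl b \in C).
    exact: subsetP sCF _ bC.
  apply: (subsetP (cl_sub_flat fF (subset_trans (subsetDl C [set inr s]) sCF))).
  rewrite mem_cl_indep //; apply/orP; right; apply/fundamentalP=> -[f fbC].
  have fC := matchesS (subsetUr _ _) fbC.
  have [|y yC fy] := circuit_star (b := b) cC sC fC; first by rewrite starE.
  have eqy : y = inl b.
    apply: fbC.1; rewrite ?setU11 //; first exact: setU1r.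
    by rewrite fy (matches_inl fbC) ?setU11.
  by move: yC bC; rewrite eqy => /setD1P[_ ->].
have : flat_of (base_part F) \subset F.
  by rewrite -cl_inl; apply: cl_sub_flat => //; apply/subsetP=> _ /imsetP[b + ->]; rewrite inE.
by move/subsetP; apply; rewrite inr_flat_of.
Qed.

Lemma cyclic_flatE F : is_cyclic_flat M F -> F = flat_of (base_part F).
Proof.
move=> cF; apply/setP=> -[b|s]; first by rewrite inl_flat_of base_partE.
by rewrite inr_flat_of cyclic_flat_inr.
Qed.

(** Take a circuit [C] in [F] through [inl b]. A matching of the rest of [C] must use [b], and only
    some [inr s] can be the element matched to it. *)
Lemma base_part_cyclic_flat F : is_cyclic_flat M F ->
  {in base_part F, forall b, exists2 s, N s \subset base_part F & b \in N s}.
Proof.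
move=> cfF b; rewrite base_partE => bF; have /andP[fF /is_cyclicP cF] := cfF.
have [C cC /andP[bC sCF]] := cF _ bF.
have /fundamentalP[f fC] := circuit_setD1_indep cC bC.
have [|y yC fy] := circuit_star (b := b) cC bC fC; first by rewrite starE.
case: y yC fy => [c|s] yC fy.
  by rewrite (matches_inl fC yC) in fy; rewrite fy setD11 in yC.
exists s; last by rewrite -inr_star -fy; apply: fC.2.
by rewrite -cyclic_flat_inr // (subsetP sCF) //; case/setD1P: yC.
Qed.

(* A basis of [fundamental] matches its elements [inr s] bijectively with the
   missing elements [inl b]; read backwards, this matches the complement. *)
Lemma dual_fundamental X :
  X \in indep (dual M) <-> partial_transversal costar X.
Proof.
apply: iff_trans (partial_transversalP s0 costar X); rewrite inE.
split=> [/existsP[D /andP[]]|[g [injg Ag]]].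
  rewrite basis_rank rank_fundamental => /andP[/fundamentalP[f fD] /eqP cD] sXD.
  have XD x : x \in X -> x \in D = false by move/(subsetP sXD); rewrite inE => /negbTE.
  have fT : f @: D = setT.
    by apply/eqP; rewrite eqEcard subsetT cardsT (card_in_imset fD.1) cD leqnn.
  (* On [X] the default [s0] is never taken, since [f] maps the basis [D] onto all vertices. *)
  pose g x := match x with
    | inl b => odflt s0 [pick s | (inr s \in D) && (f (inr s) == b)]
    | inr s => s
    end.
  have gP b : inl b \in X -> inr (g (inl b)) \in D /\ f (inr (g (inl b))) = b.
    move=> bX; rewrite /=; case: pickP => [s /andP[sD /eqP]|no_s] //.
    have : b \in f @: D by rewrite fT inE.
    case/imsetP=> -[c|s] yD fy; last by have := no_s s; rewrite yD -fy eqxx.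
    by rewrite fy (matches_inl fD yD) in bX; rewrite XD in yD.
  exists g; split=> [[b|s] [c|t] xX yX|[b|s] xX] //.
  - by move=> eqg; have [_ fb] := gP _ xX; have [_ fc] := gP _ yX; rewrite -fb eqg fc.
  - by move=> eqg; have [] := gP _ xX; rewrite eqg XD.
  - by move=> eqg; have [] := gP _ yX; rewrite -eqg XD.
  - by move=> /= ->.
  - by have [sD fs] := gP _ xX; have := fD.2 _ sD; rewrite !starE fs.
  by rewrite starE eqxx.
(* Conversely, exchanging each [inl b] in [X] for the [inr s] with [s] its partner gives a basis
   avoiding [X]. *)
pose h b : B + S := if inl b \in X then inr (g (inl b)) else inl b.
have injh : injective h.
  move=> b c; rewrite /h; case: ifP => bX; case: ifP => cX //; last by case.
  by case=> /injg-/(_ bX cX)[].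
apply/existsP; exists (h @: setT); rewrite basis_rank rank_fundamental.
rewrite card_imset // cardsT eqxx andbT; apply/andP; split.
  apply: transversal_indep_imset => // b; rewrite /h; case: ifP => bX; last by rewrite starE.
  by rewrite starE -inl_costar Ag.
apply/subsetP=> x xX; rewrite inE; apply/imsetP=> -[b _ def_x].
move: def_x; rewrite /h; case: ifP => bX def_x; last by rewrite -def_x xX in bX.
(* An [inr s] in [X] has partner [s], which is already the partner of [inl b]. *)
have := Ag _ xX; rewrite {1}def_x starE => /eqP eqg.
by have := injg _ _ bX xX eqg; rewrite def_x.
Qed.

End Fundamental.

(** * Greatest elements and isomorphisms of lattices *)

Lemma ex_max_join (d : Order.disp_t) (L : finLatticeType d) (T : {set L}) x0 :
  x0 \in T -> {in T &, forall x y, Order.join x y \in T} ->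
  exists2 x, x \in T & {in T, forall y, (y <= x)%O}.
Proof.
move=> x0T joinT.
suff [x xT le_x] : exists2 x, x \in T & {in enum T, forall y, (y <= x)%O}.
  by exists x => // y yT; apply: le_x; rewrite mem_enum.
have: {subset enum T <= T} by move=> y; rewrite mem_enum.
(* The members of [T] are joined one after another, starting from [x0]. *)
elim: (enum T) => [|z s IHs] sT; first by exists x0.
have [|x xT le_x] := IHs; first by move=> y ys; apply: sT; rewrite inE ys orbT.
have zT : z \in T by apply: sT; rewrite mem_head.
exists (Order.join z x); first exact: joinT.
by move=> y /predU1P[->|/le_x le_yx]; rewrite lexU2 ?lexx ?le_yx ?orbT.
Qed.

(** Meets and joins are determined by the order; surjectivity lets the universal property in [L'] be
    tested on images of [L]. *)
Lemma lattice_isomorphic_mono (d d' : Order.disp_t)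
    (L : latticeType d) (L' : latticeType d') (f : L -> L') :
  bijective f -> {mono f : x y / (x <= y)%O} -> lattice_isomorphic L L'.
Proof.
move=> bij_f mono_f; exists f; split=> // x y; have [g gK fK] := bij_f.
  apply/le_anti; rewrite lexI !mono_f.
  rewrite leIl leIr /= -[X in (X <= _)%O]fK mono_f.
  by rewrite lexI -!mono_f fK leIl leIr.
apply/le_anti; rewrite leUx !mono_f.
rewrite leUl leUr /= andbT -[X in (_ <= X)%O]fK mono_f.
by rewrite leUx -!mono_f fK leUl leUr.
Qed.

(* A finLatticeType may be empty in this library; lattices are nonempty. *)
Theorem theorem2p1 (d : Order.disp_t) (L : finLatticeType d) (L_gt0 : 0 < #|L|) :
  exists (E : finType) (M : matroid E),
    bitransversal_matroid M /\ lattice_isomorphic L (cyclic_flat M).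
Proof.
have /card_gt0P[x0 _] := L_gt0.
pose N (x : L) := [set y | ~~ (x <= y)%O].
have subN x y : (N x \subset N y) = (x <= y)%O.
  apply/subsetP/idP => [sN|le_xy z].
    (* The point [y] is never in [N y], so it is not in [N x] either. *)
    by have := sN y; rewrite !inE lexx; case: (x <= y)%O => // /(_ isT).
  by rewrite !inE; apply: contra; apply: le_trans.
exists (L + L)%type, (fundamental x0 N); split.
  split; first exact: transversal_matroid_transversal.
  by exists L, (costar N) => X; apply: dual_fundamental.
have cN x : {in N x, forall y, exists2 z, N z \subset N x & y \in N z} by exists x.
pose f x := CyclicFlat (is_cyclic_flat_of x0 (cN x)).
have mono_f : {mono f : x y / (x <= y)%O}.
  move=> x y; rewrite {1}/Order.le /= /le_cyclic_flat /=; apply/subsetP/idP => [sxy|le_xy].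
    (* The point [inr x] lies in [f x], and it lies in [f y] only if [N x \subset N y]. *)
    by have := sxy (inr x); rewrite !inr_flat_of !subN lexx; apply.
  case=> z; first by rewrite !inl_flat_of; apply/subsetP; rewrite subN.
  by rewrite !inr_flat_of !subN => /le_trans; apply.
apply: (lattice_isomorphic_mono (f := f)) => //.
(* The least element is the greatest one of the dual order [L^d]. Its face is empty, so it starts
   the search for the largest face inside [Y]. *)
have [bot _ le_bot] : exists2 x : L, x \in setT & {in [set: L], forall y, (x <= y)%O}.
  apply: (@ex_max_join _ L^d setT x0); first exact: in_setT.
  by move=> *; exact: in_setT.
have surj_f (F : cyclic_flat (fundamental x0 N)) : exists x, F == f x.
  have cF := cyclic_flatP F; set Y := base_part F.
  (* The candidates are closed under joins because [N] turns a join into a union. *)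
  have [||x] := @ex_max_join _ L [set x | N x \subset Y] bot.
  - rewrite inE; apply/subsetP=> y; rewrite inE le_bot //; exact: in_setT.
  - move=> x y; rewrite !inE => /subsetP sx /subsetP sy; apply/subsetP=> z.
    rewrite inE leUx negb_and => /orP[zx|zy].
      by apply: sx; rewrite inE.
    by apply: sy; rewrite inE.
  rewrite inE => sxY max_x; exists x; apply/eqP/val_inj => /=.
  rewrite (cyclic_flatE cF); congr flat_of; apply/eqP; rewrite eqEsubset sxY andbT.
  (* Every point of [Y] lies in a face [N z] inside [Y], and [z <= x] by maximality, so [N x] is all
     of [Y]. *)
  apply/subsetP=> y /(base_part_cyclic_flat cF)[z szY].
  by apply/subsetP; rewrite subN max_x ?inE.
exists (fun F => xchoose (surj_f F)) => [x|F]; last exact/esym/eqP/(xchooseP (surj_f F)).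
have /eqP eqf := xchooseP (surj_f (f x)).
by apply/le_anti; rewrite -!mono_f -eqf !lexx.
Qed.
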